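(* Let $d$ be a positive integer and $\alpha\in(0,1)$. There exists $\beta=\beta(\alpha,d)>0$ such that the following holds. If $S$ is a finite set in $\mathbb{R}^d$ and $\mathcal{B}$ is a finite family of axis-parallel boxes of $\mathbb{R}^d$ such that at least $\alpha\binom{|\mathcal{B}|}{d+1}$ of the $(d+1)$-element subfamilies of $\mathcal{B}$ have the property that their intersection contains a point of $S$, then there is a subfamily of at least $\beta|\mathcal{B}|$ sets of $\mathcal{B}$ whose intersection contains a point of $S$.
   Context: An axis-parallel box in $\mathbb{R}^d$ is a set of the form $[a_1,b_1]\times\cdots\times[a_d,b_d]$ with $a_i\le b_i$ real numbers.
   Formalization: The family is assumed to have at least d+1 boxes; for fewer boxes the binomial coefficient is 0, the hypothesis is vacuous, and the claim fails (for example S empty and a single box). *)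

(* Defs.v *)
From HB Require Import structures.
From mathcomp Require Import all_boot all_order all_algebra.
From mathcomp Require Import all_classical all_reals.

Set Implicit Arguments.
Unset Strict Implicit.
Unset Printing Implicit Defensive.

Import Order.TTheory GRing.Theory Num.Theory.

Local Open Scope classical_set_scope.
Local Open Scope ring_scope.

Definition axis_box (R : realType) (d : nat) (a b : 'rV[R]_d) : set 'rV[R]_d :=
  [set x | forall i : 'I_d, x 0 i \in `[a 0 i, b 0 i]].

Definition is_axis_box (R : realType) (d : nat) (A : set 'rV[R]_d) : Prop :=
  exists a b : 'rV[R]_d,
    (forall i : 'I_d, a 0 i <= b 0 i) /\ A = axis_box a b.

(* A finite family of sets is indexed by a finite type [I], so repetitions are
   allowed; a subfamily is given by its set of indices [J : {set I}]. *)
Definition meets_in (R : realType) (d : nat) (S : set 'rV[R]_d) (I : finType)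
    (B : I -> set 'rV[R]_d) (J : {set I}) : Prop :=
  exists2 x, S x & (\bigcap_(i in [set` J]) B i) x.

Definition meeting_subfamilies (R : realType) (d : nat) (S : set 'rV[R]_d)
    (I : finType) (B : I -> set 'rV[R]_d) (k : nat) : {set {set I}} :=
  [set J : {set I} | (#|J| == k) && `[< meets_in S B J >]]%SET.

(* Main.v *)
(* Matousek's argument: bounded dual shatter functions yield fractional Helly
   numbers. Put k = d + 1, n = |I| and suppose every point of S lies in fewer
   than n/(2m) boxes. Fix a point x_J for each meeting k-set J. In a random
   sample of m boxes, a positive proportion (independent of m) of the k-sets of
   positions carry a meeting k-set J such that x_J lies in no other sampled box,
   and then the k-set is the trace of x_J on the sample. This produces c * m^k
   distinct traces, whereas m boxes have only (2m + 1)^d = O(m^(k - 1)) of them: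
   a contradiction once m is large. *)
Require Import Defs.
From HB Require Import structures.
From mathcomp Require Import all_boot all_order all_algebra.
From mathcomp Require Import all_classical all_reals.
From mathcomp Require Import zify ring lra.

Set Implicit Arguments.
Unset Strict Implicit.
Unset Printing Implicit Defensive.

Import Order.TTheory GRing.Theory Num.Theory.

Local Open Scope classical_set_scope.
Local Open Scope ring_scope.

(** After multiplication by [k!], both sides are products over [i < k], and
    [(k - i) * n <= k * (n - i)] holds factor by factor. *)
Lemma expn_le_bin (n k : nat) : (k <= n)%N -> (n ^ k <= k ^ k * 'C(n, k))%N.
Proof.
move=> lekn; rewrite -(leq_pmul2r (fact_gt0 k)) -mulnA bin_ffact -ffactnn.
have expE (x : nat) : (x ^ k = \prod_(i < k) x)%N by rewrite prod_nat_const card_ord.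
rewrite !ffact_prod !expE -!big_split.
by apply: leq_prod => i _ /=; have := ltn_ord i; nia.
Qed.

Lemma bernoulli_ineq (R : realFieldType) (b : R) (n : nat) :
  0 <= b <= 1 -> 1 - n%:R * b <= (1 - b) ^+ n.
Proof.
move=> /andP[b0 b1]; elim: n => [|n IH]; first by rewrite mul0r subr0 expr0.
have h : (1 - b) * (1 - n%:R * b) <= (1 - b) * (1 - b) ^+ n.
  by rewrite ler_wpM2l // subr_ge0.
rewrite exprS; apply: le_trans h; rewrite -natr1.
have : 0 <= n%:R * b * b by rewrite !mulr_ge0.
by lra.
Qed.

Lemma sum_nat_of_bool (T : finType) (P Q : pred T) :
  (\sum_(t | P t) Q t = #|[set t | P t && Q t]%SET|)%N.
Proof.
by rewrite -sum1dep_card big_mkcondr; apply: eq_bigr => t _; case: (Q t).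
Qed.

Section Traces.
Variables (X : Type) (I : finType) (mem : I -> pred X).

(** Traces are sets of positions, not of indices, because a sample [f] may repeat an index. *)
Definition trace (m : nat) (f : 'I_m -> I) (x : X) : {set 'I_m} :=
  [set j | mem (f j) x]%SET.

Lemma exists_imset_eq (m : nat) (K : {set 'I_m}) (J : {set I}) :
  #|K| = #|J| -> (0 < #|J|)%N -> exists phi : 'I_m -> I, phi @: K = J.
Proof.
move=> KJ /card_gt0P[i0 _]; exists (fun j => nth i0 (enum J) (index j (enum K))).
apply/setP => i; apply/imsetP/idP => [[j jK ->]|iJ].
  by rewrite -mem_enum mem_nth // -cardE -KJ cardE index_mem mem_enum.
have lti : (index i (enum J) < size (enum K))%N.
  by rewrite -cardE KJ cardE index_mem mem_enum.
have j0 : 'I_m by case: (enum K) lti => [|j s].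
exists (nth j0 (enum K) (index i (enum J))).
  by rewrite -mem_enum mem_nth.
by rewrite index_uniq ?enum_uniq // nth_index // mem_enum.
Qed.

(* Double counting of the pairs (f, K), with f a sample of m indices and K a set
   of k positions, such that J = f @: K is in G and the point x J lies in none
   of the sampled sets outside K: then K is the trace of x J on the sample. *)
Lemma trace_count (k m N c : nat) (G : {set {set I}}) (x : {set I} -> X) :
    (0 < k)%N -> (forall J, J \in G -> #|J| = k) ->
    (forall J i, J \in G -> i \in J -> mem i (x J)) ->
    (forall J, J \in G -> (c <= #|[set i | ~~ mem i (x J)]%SET|)%N) ->
    (forall (f : 'I_m -> I) (F : {set {set 'I_m}}),
       (forall K, K \in F -> exists x, trace f x = K) -> (#|F| <= N)%N) ->
  ('C(m, k) * (#|G| * c ^ (m - k)) <= #|I| ^ m * N)%N.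
Proof.
move=> k0 Gk Gx Gc traceN.
pose P (f : {ffun 'I_m -> I}) (K : {set 'I_m}) :=
  (f @: K \in G) && [forall j, (j \notin K) ==> ~~ mem (f j) (x (f @: K))].
have upper f : (\sum_(K : {set 'I_m} | #|K| == k) P f K <= N)%N.
  rewrite sum_nat_of_bool.
  apply: (traceN f) => K; rewrite inE => /andP[_ /andP[fKG /forallP out]].
  exists (x (f @: K)); apply/setP => j; rewrite inE.
  have [jK|jK] := boolP (j \in K); first by rewrite Gx ?imset_f.
  by apply/negbTE; have := out j; rewrite jK.
have lower (K : {set 'I_m}) : #|K| = k ->
    (#|G| * c ^ (m - k) <= \sum_(f : {ffun 'I_m -> I}) P f K)%N.
  move=> Kk.
  (* Splitting by the value [J] of [f @: K] makes the point [x J] independent of [f], so each [J]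
     can be handled separately. *)
  have split_P f : (P f K = \sum_(J in G)
      ((f @: K == J) && [forall j, (j \notin K) ==> ~~ mem (f j) (x J)]) :> nat)%N.
    rewrite /P; have [fG|fG] := boolP (f @: K \in G); last first.
      rewrite big1 // => J JG; case: eqP => // fJ.
      by rewrite fJ JG in fG.
    rewrite (bigD1 (f @: K)) //= eqxx big1 ?addn0 // => J /andP[_ ].
    by rewrite eq_sym => /negbTE ->.
  rewrite (eq_bigr _ (fun f _ => split_P f)) exchange_big /= -sum_nat_const.
  apply: leq_sum => J JG; rewrite sum_nat_of_bool.
  have [phi phiK] : exists phi : 'I_m -> I, phi @: K = J.
    by apply: exists_imset_eq; rewrite ?Kk Gk.
  (* It suffices to count the samples that agree with one fixed [phi] on [K] and choose freely,
     elsewhere, among the at least [c] sets missing [x J]. *)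
  pose A j := if j \in K then [set phi j]%SET else [set i | ~~ mem i (x J)]%SET.
  have cA : (c ^ (m - k) <= #|family (fun j => [in A j])|)%N.
    rewrite card_family foldrE big_image /= (bigID (fun j => j \in K)) /=.
    rewrite big1 ?mul1n => [|j jK]; last by rewrite /A jK cards1.
    have -> : (m - k = #|~: K|)%N by rewrite cardsCs finset.setCK card_ord Kk.
    rewrite -prod_nat_const big_mkcond [leqRHS]big_mkcond /=.
    apply: leq_prod => j _; rewrite inE; case: ifP => // /negbTE jK.
    by rewrite /A jK Gc.
  apply: leq_trans cA _; apply: subset_leq_card.
  apply/fintype.subsetP => f /familyP fA; rewrite inE /=.
  have fphi j : j \in K -> f j = phi j.
    by move=> jK; have := fA j; rewrite /A jK => /set1P.
  apply/andP; split; first by rewrite (eq_in_imset fphi) phiK.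
  apply/forallP => j; apply/implyP => /negbTE jK.
  by have := fA j; rewrite /A jK !inE.
have : (\sum_(K : {set 'I_m} | #|K| == k) \sum_(f : {ffun 'I_m -> I}) P f K
        <= #|I| ^ m * N)%N.
  rewrite exchange_big /=.
  have -> : (#|I| ^ m = #|{ffun 'I_m -> I}|)%N by rewrite card_ffun card_ord.
  rewrite -sum_nat_const.
  by apply: leq_sum => f _; exact: upper.
apply: leq_trans.
have -> : 'C(m, k) = #|[set K : {set 'I_m} | #|K| == k]%SET|.
  by rewrite card_draws card_ord.
rewrite -sum_nat_const big_set /=.
by apply: leq_sum => K /eqP; exact: lower.
Qed.

End Traces.

(** In each coordinate the trace depends only on the place of [x 0 i] among the [2 * m] endpoints,
    which leaves [2 * m + 1] possibilities. *)
Lemma card_box_traces (R : realType) (d m : nat) (a b : 'I_m -> 'rV[R]_d)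
    (F : {set {set 'I_m}}) :
  (forall K, K \in F -> exists x : 'rV[R]_d,
     [set j | [forall i, a j 0 i <= x 0 i <= b j 0 i]]%SET = K) ->
  (#|F| <= (2 * m).+1 ^ d)%N.
Proof.
move=> /= FT.
have /choice[x xF] : forall K, exists y : 'rV[R]_d, K \in F ->
    [set j | [forall i, a j 0 i <= y 0 i <= b j 0 i]]%SET = K.
  move=> K; have [/FT [y yK]|nF] := boolP (K \in F); first by exists y.
  by exists 0.
pose low i (t : R) := [set j | a j 0 i <= t]%SET.
pose up i (t : R) := [set j | b j 0 i < t]%SET.
(* This counts the endpoints passed by [t]. A right endpoint counts only once strictly exceeded,
   since boxes are closed: [t] lies in the [j]-th interval iff [j] is in [low i t] but not in
   [up i t]. *)
pose code0 i t := (#|low i t| + #|up i t|)%N.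
have code_lt i t : (code0 i t < (2 * m).+1)%N.
  have cm (A : {set 'I_m}) : (#|A| <= m)%N by rewrite -[leqRHS]card_ord max_card.
  by rewrite ltnS mul2n -addnn leq_add.
(* Both sets grow with t, so equality of the sums of their sizes forces
   equality of both sets. *)
have code_inj i t u : code0 i t = code0 i u -> low i t = low i u /\ up i t = up i u.
  wlog tu : t u / t <= u => [hw|].
    by case: (leP t u) => [/hw//|/ltW /hw h /esym /h [-> ->]].
  have sl : low i t \subset low i u.
    by apply/fintype.subsetP => j; rewrite !inE => /le_trans; apply.
  have su : up i t \subset up i u.
    by apply/fintype.subsetP => j; rewrite !inE => /lt_le_trans; apply.
  have arith (p p' q q' : nat) :
      (p + q = p' + q' -> p <= p' -> q <= q' -> (p' <= p) && (q' <= q))%N by lia.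
  move=> /arith/(_ (subset_leq_card sl) (subset_leq_card su))/andP[le_low le_up].
  by split; apply/eqP; rewrite eqEcard ?sl ?su.
pose code K : {ffun 'I_d -> 'I_(2 * m).+1} :=
  [ffun i => Ordinal (code_lt i (x K 0 i))].
have cinj : {in F &, injective code}.
  move=> K L KF LF /ffunP e; rewrite -(xF K KF) -(xF L LF).
  apply/setP => j; rewrite !inE; apply: eq_forallb => i.
  have := e i; rewrite !ffunE => /(congr1 val) /= /code_inj
    [/setP/(_ j) + /setP/(_ j)].
  by rewrite !inE !ltNge => -> /negb_inj ->.
rewrite -(card_in_imset cinj); apply: leq_trans (max_card _) _.
by rewrite card_ffun !card_ord.
Qed.

Theorem theorem1p3 (R : realType) (d : nat) (hd : (0 < d)%N)
    (alpha : R) (halpha0 : 0 < alpha) (halpha1 : alpha < 1) :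
  exists2 beta : R, 0 < beta &
    forall (S : set 'rV[R]_d) (I : finType) (B : I -> set 'rV[R]_d),
      finite_set S ->
      (forall i : I, is_axis_box (B i)) ->
      (d.+1 <= #|I|)%N ->
      alpha * 'C(#|I|, d.+1)%:R <= #|meeting_subfamilies S B d.+1|%:R ->
      exists J : {set I},
        beta * #|I|%:R <= #|J|%:R /\ meets_in S B J.
Proof.
(* The factor 2 pays for [c_large], each [d.+1 ^ d.+1] for replacing a binomial by a power, and
   [3 ^ d] for [2 * m + 1 <= 3 * m]. *)
have [m [dm m_large]] : exists m, (d < m)%N /\
    (2 * d.+1 ^ d.+1 * d.+1 ^ d.+1 * 3 ^ d)%:R < m%:R * alpha.
  set C := (2 * _ * _ * _)%N.
  have [p] : exists p : nat, C%:R / alpha < p%:R.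
    exists (Num.bound (C%:R / alpha)); apply: archi_boundP.
    by rewrite divr_ge0 ?ler0n ?(ltW halpha0).
  rewrite ltr_pdivrMr // => hp; exists (p + d.+1)%N; split; first by lia.
  by apply: lt_le_trans hp _; rewrite ler_pM2r // ler_nat leq_addr.
have m0 : (0 < m)%N by lia.
have m0R : 0 < m%:R :> R by rewrite ltr0n.
exists (2 * m%:R)^-1; first by rewrite invr_gt0 mulr_gt0.
move=> S I B _ boxB dI many; apply: contrapT => noJ.
have /choice[ab abE] : forall i, exists ab : 'rV[R]_d * 'rV[R]_d,
    B i = axis_box ab.1 ab.2.
  by move=> i; have [a [b [_ e]]] := boxB i; exists (a, b).
pose mem i : pred 'rV[R]_d :=
  fun x => [forall l, (ab i).1 0 l <= x 0 l <= (ab i).2 0 l].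
have memP i x : B i x <-> mem i x.
  rewrite abE /mem /axis_box /=; split => [h|/forallP h l].
    by apply/forallP => l; have := h l; rewrite in_itv.
  by rewrite in_itv; exact: h.
set G := meeting_subfamilies _ _ _ in many.
have /choice[x xG] : forall J, exists y, J \in G ->
    S y /\ forall i, i \in J -> mem i y.
  move=> J; have [|nG] := boolP (J \in G); last by exists 0.
  rewrite inE => /andP[_ /asboolP[y Sy yJ]]; exists y => _; split=> // i iJ.
  by apply/memP; apply: yJ.
set n := #|I| in dI many noJ *.
(* By [noJ], a point of [S] lies in at most [n %/ (2 * m)] boxes, hence misses at least [c] of
   them. *)
pose c := (n - n %/ (2 * m))%N.
have few J : J \in G -> (c <= #|[set i | ~~ mem i (x J)]%SET|)%N.
  move=> /xG[SJ _]; rewrite leqNgt; apply/negP => hc; apply: noJ.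
  exists [set i | mem i (x J)]%SET; split; last first.
    by exists (x J) => // i /=; rewrite inE => ?; apply/memP.
  have := cardsC [set i | mem i (x J)]%SET.
  have -> : (~: [set i | mem i (x J)] = [set i | ~~ mem i (x J)])%SET.
    by apply/setP => i; rewrite !inE.
  rewrite -/n ler_pdivrMl ?mulr_gt0 // -!natrM ler_nat.
  move: hc; rewrite /c; set u := #|_|; set v := #|_|.
  have := leq_divM n (2 * m).
  have := @ltn_ceil n (2 * m); rewrite muln_gt0 m0 => /(_ isT).
  set q := (n %/ _)%N => h1 h2 h3 h4.
  have qv : (q < v)%N by lia.
  nia.
have key : ('C(m, d.+1) * (#|G| * c ^ (m - d.+1)) <= n ^ m * (2 * m).+1 ^ d)%N.
  apply: (trace_count (mem := mem) (x := x)) => //.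
  - by move=> J; rewrite inE => /andP[/eqP].
  - by move=> J i /xG[_]; apply.
  move=> f F FT.
  apply: (card_box_traces (a := fun j => (ab (f j)).1) (b := fun j => (ab (f j)).2)).
  by move=> K /FT[y <-]; exists y.
(* By Bernoulli, [(1 - 1/(2m))^(m-d-1) >= 1 - (m-d-1)/(2m) >= 1/2]; this is what the choice of
   [beta] as [1/(2m)] is for. *)
have c_large : n%:R ^+ (m - d.+1) <= 2 * c%:R ^+ (m - d.+1) :> R.
  have cR : (1 - (2 * m%:R)^-1) * n%:R <= c%:R :> R.
    rewrite mulrBl mul1r /c natrB ?leq_div // lerD2l lerN2.
    rewrite ler_pdivlMl ?mulr_gt0 // -!natrM ler_nat mulnC.
    exact: leq_divM.
  have b01 : 0 <= ((2 * m%:R)^-1 : R) <= 1.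
    rewrite invr_ge0 mulr_ge0 ?ler0n //= invf_le1 ?mulr_gt0 //.
    by rewrite -natrM ler1n; lia.
  have half : 2^-1 <= (1 - (2 * m%:R)^-1) ^+ (m - d.+1) :> R.
    apply: le_trans (bernoulli_ineq _ b01).
    rewrite lerBrDr -lerBrDl.
    have -> : 1 - 2^-1 = m%:R * (2 * m%:R)^-1 :> R.
      by rewrite invfM mulrCA mulfV ?lt0r_neq0 //; lra.
    by rewrite ler_pM2r ?invr_gt0 ?mulr_gt0 // ler_nat leq_subr.
  have b0n : 0 <= (1 - (2 * m%:R)^-1) * n%:R :> R.
    by case/andP: b01 => *; rewrite mulr_ge0 ?subr_ge0.
  have := @lerXn2r R (m - d.+1) _ _ b0n (ler0n _ c) cR.
  rewrite exprMn => cR_exp; rewrite -ler_pdivrMl //; apply: le_trans cR_exp.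
  by rewrite ler_wpM2r // exprn_ge0.
have bin_n := expn_le_bin dI; have bin_m := expn_le_bin dm.
have m3 : ((2 * m).+1 ^ d <= 3 ^ d * m ^ d)%N by rewrite -expnMn leq_exp2r //; lia.
(* ['C(m, d.+1)] contributes [m ^ d.+1] on the left, against [m ^ d] from the traces on the right;
   cancelling [m ^ d * n ^ m] leaves one factor [m], which contradicts [m_large]. *)
have : m%:R * alpha * (m ^ d * n ^ m)%:R <=
   (2 * d.+1 ^ d.+1 * d.+1 ^ d.+1 * 3 ^ d)%:R * (m ^ d * n ^ m)%:R.
  have -> : m%:R * alpha * (m ^ d * n ^ m)%:R =
      alpha * (m ^ d.+1 * n ^ d.+1)%:R * n%:R ^+ (m - d.+1).
    have -> : (n ^ m = n ^ d.+1 * n ^ (m - d.+1))%N by rewrite -expnD subnKC.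
    rewrite (expnS m) !natrM !natrX; move: (m - d.+1)%N => e.
    by ring.
  have step1 : alpha * (m ^ d.+1 * n ^ d.+1)%:R * n%:R ^+ (m - d.+1) <=
      alpha * (d.+1 ^ d.+1 * 'C(m, d.+1) * (d.+1 ^ d.+1 * 'C(n, d.+1)))%:R *
      (2 * c%:R ^+ (m - d.+1)).
    apply: ler_pM => //; first by rewrite mulr_ge0 ?ler0n // ltW.
      by rewrite exprn_ge0.
    by rewrite ler_pM2l // ler_nat leq_mul.
  apply: le_trans step1 _.
  set K := (d.+1 ^ d.+1)%N.
  have -> : alpha * (K * 'C(m, d.+1) * (K * 'C(n, d.+1)))%:R *
      (2 * c%:R ^+ (m - d.+1)) =
     (alpha * 'C(n, d.+1)%:R) * (2 * K * K * ('C(m, d.+1) * c ^ (m - d.+1)))%:R.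
    by rewrite !natrM natrX; ring.
  apply: le_trans (ler_wpM2r (ler0n _ _) many) _.
  rewrite -!natrM ler_nat.
  have := leq_mul (leqnn (2 * K * K)%N)
    (leq_trans key (leq_mul (leqnn (n ^ m)%N) m3)).
  by congr leq; ring.
rewrite ler_pM2r ?ltr0n ?muln_gt0 ?expn_gt0 ?m0 //; last by rewrite (leq_trans _ dI).
by rewrite leNgt m_large.
Qed.
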